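(* Let $X$ be a compact metric space, let $f,g:X\to X$ be a synchronously tame pair of maps, and suppose the synchronization zeta function $S_{f,g}(z)$ is rational. Let $\lambda(f,g)$ and $n(f,g)$ be as defined in the context. Then one of the following three possibilities holds: (i) $\#S(f^k,g^k)=0$ for all $k=1,2,\dots$. (ii) The sequence $\{\#S(f^k,g^k)/\lambda(f,g)^k\}_{k=1}^\infty$ has the same set of limit points as a periodic sequence $\left\{\sum_{j=1}^{n(f,g)}\alpha_j\epsilon_j^k\right\}_{k=1}^\infty$, where $\alpha_j\in\mathbb Z$, $\epsilon_j\in\mathbb C$ and $\epsilon_j^q=1$ for some integer $q>0$. (iii) The set of limit points of the sequence $\{\#S(f^k,g^k)/\lambda(f,g)^k\}_{k=1}^\infty$ contains an interval.
   Context: $S(f^n,g^n)=\{x\in X:f^n(x)=g^n(x)\}$. The pair is synchronously tame if $\#S(f^n,g^n)<\infty$ for all $n\ge1$. The synchronization zeta function is $S_{f,g}(z)=\exp\left(\sum_{n\ge1}\frac{\#S(f^n,g^n)}{n}z^n\right)$. When $S_{f,g}(z)$ is rational, one can write $\#S(f^k,g^k)=\sum_{i=1}^r\chi_i\lambda_i^k$ for all $k\ge1$, with $\chi_i$ nonzero integers and $\lambda_i$ distinct nonzero algebraic integers; the $\lambda_i$ are exactly the inverses of the zeros and poles of $S_{f,g}$. Put $\lambda(f,g)=\max_i|\lambda_i|$ (with $\lambda(f,g)=0$ if there are no $\lambda_i$) and $n(f,g)=\#\{i:|\lambda_i|=\lambda(f,g)\}$. An interval means a non-degenerate interval of $\mathbb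 R$. *)

(* Defs.v *)
From HB Require Import structures.
From mathcomp Require Import all_boot all_order all_algebra.
From mathcomp Require Import all_classical all_reals all_analysis.
From mathcomp Require Import finmap complex.

Set Implicit Arguments.
Unset Strict Implicit.
Unset Printing Implicit Defensive.

Import Order.TTheory GRing.Theory Num.Theory.
Import numFieldNormedType.Exports.

Local Open Scope classical_set_scope.
Local Open Scope complex_scope.
Local Open Scope ring_scope.

(* Formal power series over [F] are given by their coefficient sequences. *)

(* Coefficients of exp(A) = \sum_m A^m / m! for a series A with zero constant
   term. Since A^m then has order at least m, the coefficient of z^n only
   involves m <= n and the truncation of A to degree n. *)
Definition fps_exp (F : fieldType) (a : nat -> F) : nat -> F := fun n =>
  \sum_(m < n.+1) ((\poly_(i < n.+1) a i) ^+ m)`_n / (m`!)%:R.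

(* Q * A = P as formal power series, for polynomials P and Q != 0. *)
Definition fps_rational (F : fieldType) (a : nat -> F) : Prop :=
  exists P Q : {poly F}, Q != 0 /\
    forall n, \sum_(i < n.+1) Q`_i * a (n - i)%N = P`_n.

(* The limits of the convergent subsequences; the initial terms of [u] are
   irrelevant. *)
Definition limit_points (K : numFieldType) (u : nat -> K) : set K :=
  cluster (u @ \oo).

Definition nondegenerate_interval (R : realType) (I : set R) : Prop :=
  is_interval I /\ exists x y, [/\ I x, I y & x < y].

Section Synchronization.
Variables (T : choiceType) (f g : T -> T).

Definition sync_set (n : nat) : set T := [set x | iter n f x = iter n g x].

Definition sync_tame : Prop :=
  forall n, (0 < n)%N -> finite_set (sync_set n).

(* Meaningful when [sync_set n] is finite ([fset_set] of an infinite set is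
   empty). *)
Definition sync_card (n : nat) : nat := #|` fset_set (sync_set n)|.

Variable R : realType.

(* The series with coefficients #S(f^n, g^n) / n for n >= 1. *)
Definition sync_log_zeta (n : nat) : R[i] :=
  if n is 0%N then 0 else (sync_card n)%:R / n%:R.

Definition sync_zeta : nat -> R[i] := fps_exp sync_log_zeta.

(* [s] lists the pairs (chi_i, lambda_i). *)
Definition is_sync_expansion (s : seq (int * R[i])) : Prop :=
  [/\ uniq [seq p.2 | p <- s],
      (forall p, p \in s ->
        [/\ p.1 != 0, p.2 != 0 & integralOver (intr : int -> R[i]) p.2])
    & forall k, (0 < k)%N ->
        (sync_card k)%:R = \sum_(p <- s) p.1%:~R * p.2 ^+ k].

(* Expansions are unique up to the order of the terms; the empty default is
   only taken when there is none, which cannot happen if [sync_zeta] is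
   rational. *)
Definition sync_expansion : seq (int * R[i]) :=
  xget [::] [set s | is_sync_expansion s].

Definition sync_lambda : R :=
  \big[Num.max/0]_(p <- sync_expansion) Normc.normc p.2.

Definition sync_n : nat :=
  count (fun p => Normc.normc p.2 == sync_lambda) sync_expansion.

Definition sync_normalized (k : nat) : R :=
  (sync_card k)%:R / sync_lambda ^+ k.

End Synchronization.

Arguments sync_zeta [T] f g R _.
Arguments sync_expansion [T] f g R.
Arguments sync_lambda [T] f g R.
Arguments sync_n [T] f g R.
Arguments sync_normalized [T] f g R _.

(* Main.v *)
(** Normalized, the counts are a bounded exponential sum
    [u k = \sum_i c_i mu_i ^+ k] with [normc mu_i <= 1]; the terms with
    [normc mu_i < 1] do not affect limit points. If all unimodular [mu_i] are
    roots of unity, the remaining sum is periodic. Otherwise some unimodular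
    [mu_0] is not a root of unity. By the pigeonhole principle there is [m > 0]
    bringing all unimodular [mu_i ^+ m] close to 1, so [u] moves by small steps
    along progressions of difference [m]; but these progressions oscillate by
    an amount independent of [m], since some [mu_0 ^+ (m * t)] is far from 1.
    Hence they fill up, more and more densely, segments of length bounded
    below. *)

Require Import Defs.
From HB Require Import structures.
From mathcomp Require Import all_boot all_order all_algebra.
From mathcomp Require Import all_classical all_reals all_analysis.
From mathcomp Require Import finmap complex ring lra.

Set Implicit Arguments.
Unset Strict Implicit.
Unset Printing Implicit Defensive.

Import Order.TTheory GRing.Theory Num.Theory.
Import numFieldNormedType.Exports.

Local Open Scope classical_set_scope.
Local Open Scope complex_scope.
Local Open Scope ring_scope.

Local Notation normc := Normc.normc.

(** * Limit points of sequences and intervals of them *)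

Lemma limit_pointsP (K : numFieldType) (u : nat -> K) (x : K) :
  limit_points u x <->
  forall e : K, 0 < e -> forall N, exists2 k, (N <= k)%N & `|x - u k| < e.
Proof.
split=> [cux e e0 N|H A B [N _ NA] /nbhs_normP[e /= e0 eB]].
  have := cux [set y | exists2 k, (N <= k)%N & y = u k] (ball_ Num.norm x e).
  case; first by exists N => // k /= Nk; exists k.
    by apply/nbhs_normP; exists e.
  by move=> _ [[k Nk ->] /= xk]; exists k.
have [k Nk xk] := H e e0 N.
by exists (u k); split; [exact: NA | exact: eB].
Qed.

Lemma limit_points_eq (K : numFieldType) (u v : nat -> K) :
  (forall e : K, 0 < e -> exists N, forall k, (N <= k)%N -> `|u k - v k| < e) ->
  limit_points u = limit_points v.
Proof.
suff sub (a b : nat -> K) :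
    (forall e : K, 0 < e -> exists N, forall k, (N <= k)%N -> `|a k - b k| < e) ->
    limit_points a `<=` limit_points b.
  move=> uv; apply/seteqP; split; apply: sub => // e e0.
  by have [N HN] := uv e e0; exists N => k /HN; rewrite distrC.
move=> ab x /limit_pointsP ax; apply/limit_pointsP => e e0 N.
have e2 : 0 < e / 2 by rewrite divr_gt0.
have [N' HN'] := ab _ e2.
have [k] := ax _ e2 (maxn N N'); rewrite geq_max => /andP[Nk /HN' abk xk].
exists k => //; rewrite [e]splitr.
by rewrite (le_lt_trans (ler_distD (a k) _ _))// ltrD.
Qed.

(** At the first index where [w] reaches [x], the preceding value is still below [x], so a single
    step of size at most [e] spans [x]. *)
Lemma discrete_ivt (R : realDomainType) (w : nat -> R) (e x : R) (T : nat) :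
  0 <= e -> (forall t, `|w t.+1 - w t| <= e) -> w 0%N <= x <= w T ->
  exists t, `|x - w t| <= e.
Proof.
move=> e0 we /andP[x0 xT].
have exw : exists t, x <= w t by exists T.
case: (ex_minnP exw) => [[|t] xt tmin].
  by exists 0%N; rewrite (@le_anti _ _ x (w 0%N)) ?xt// subrr normr0.
exists t.+1; have wtx : w t < x.
  by rewrite ltNge; apply/negP => /tmin; rewrite ltnn.
have := we t; rewrite distrC !ler_norml => /andP[h1 h2].
by apply/andP; split; lra.
Qed.

(* Progressions of small steps fill up, within the step size, the segment
   between any two of their values; a cluster point of such segments of length
   at least [d] is a segment of limit points. *)
Lemma interval_of_small_steps (R : realType) (u : nat -> R) (B d : R) :
  (forall k, (0 < k)%N -> `|u k| <= B) -> 0 < d ->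
  (forall e : R, 0 < e -> forall N, exists m k t : nat, [/\ (N <= k)%N,
     forall k', (k <= k')%N -> `|u (k' + m)%N - u k'| <= e &
     d <= `|u (k + m * t)%N - u k|]) ->
  exists I : set R, nondegenerate_interval I /\ I `<=` limit_points u.
Proof.
move=> uB d0 steps.
(* At resolution [l], late values of [u] come close to every point of [a, a + d]; the bound on [a]
   lets the left ends cluster. *)
pose seg l (a : R) := `|a| <= B /\ forall x, a <= x <= a + d ->
  exists2 k, (l <= k)%N & `|x - u k| <= l.+1%:R^-1.
have /choice[a aP] l : exists a, seg l a.
  have e0 : 0 < l.+1%:R^-1 :> R by rewrite invr_gt0.
  (* Asking for indices from [l.+1] on keeps them positive, where [uB] applies. *)
  have [m [k [t [lk small far]]]] := steps _ e0 l.+1.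
  pose w i := u (k + m * i)%N.
  have wl i : (l <= k + m * i)%N by rewrite (leq_trans (ltnW lk))// leq_addr.
  have wB i : `|w i| <= B.
    by apply: uB; rewrite (leq_trans _ (leq_addr _ _))// (leq_trans _ lk).
  have wstep i : `|w i.+1 - w i| <= l.+1%:R^-1.
    by rewrite /w mulnS [(m + _)%N]addnC addnA; apply: small; rewrite leq_addr.
  have w0 : w 0%N = u k by rewrite /w muln0 addn0.
  have [le_kt|lt_tk] := leP (w 0%N) (w t).
    exists (w 0%N); split=> // x /andP[x1 x2].
    have [|i xi] := @discrete_ivt _ w _ x t (ltW e0) wstep.
      move: far; rewrite -w0 -/(w t) ger0_norm ?subr_ge0// => far.
      by apply/andP; split; lra.
    by exists (k + m * i)%N.
  (* A progression that descends from [w 0] to [w t] is negated to apply the ascending case. *)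
  exists (w t); split=> // x /andP[x1 x2].
  have wstepN i : `|- w i.+1 - - w i| <= l.+1%:R^-1.
    by rewrite -opprD normrN.
  have [|i xi] := @discrete_ivt _ (fun i => - w i) _ (- (x)) t (ltW e0) wstepN.
    move: far; rewrite -w0 -/(w t) ltr0_norm ?subr_lt0// => far.
    by apply/andP; split; lra.
  exists (k + m * i)%N => //.
  by move: xi; rewrite -opprD normrN.
have [c [_ cc]] : `[- B, B] `&` cluster (a @ \oo) !=set0.
  apply: (@segment_compact R (- B) B); exists 0%N => // l _ /=.
  by have [aB _] := aP l; rewrite in_itv /= -ler_norml.
have {}cc : limit_points a c := cc.
move/limit_pointsP: cc => cc.
(* Whenever [a l] is within [d / 4] of [c], this interval lies inside [a l, a l + d]. *)
exists [set` `[c + d / 4, c + d / 2]]; split.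
  split; first exact: interval_is_interval.
  by exists (c + d / 4), (c + d / 2); rewrite /= !in_itv /=; split; lra.
move=> x /=; rewrite in_itv /= => /andP[x1 x2].
apply/limit_pointsP => e e0 N.
have d4 : 0 < d / 4 by lra.
have [l Nl cl] := cc _ d4 (maxn N (Num.truncn e^-1)).
move: Nl; rewrite geq_max => /andP[Nl el].
have [_ /(_ x)[|k lk xk]] := aP l.
  by move: cl; rewrite ltr_norml => /andP[? ?]; apply/andP; split; lra.
exists k; first exact: leq_trans lk.
rewrite (le_lt_trans xk)// invf_plt ?posrE//.
by rewrite (lt_le_trans (truncnS_gt _))// ler_nat.
Qed.

(** * The modulus of complex numbers *)

Lemma normc_ge0 (R : rcfType) (z : R[i]) : 0 <= normc z.
Proof. by rewrite -lecR; exact: (normr_ge0 z). Qed.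

Lemma normcD (R : rcfType) (z w : R[i]) : normc (z + w) <= normc z + normc w.
Proof. by rewrite -lecR rmorphD; exact: (ler_normD z w). Qed.

Lemma normcBC (R : rcfType) (z w : R[i]) : normc (z - w) = normc (w - z).
Proof. exact: (congr1 (@complex.Re R) (distrC z w)). Qed.

Lemma normcX (R : rcfType) (z : R[i]) n : normc (z ^+ n) = normc z ^+ n.
Proof.
by elim: n => [|n IH]; [exact: Normc.normc1 | rewrite !exprS Normc.normcM IH].
Qed.

Lemma normcR (R : rcfType) (x : R) : normc x%:C = `|x|.
Proof. by rewrite /= expr0n /= addr0 sqrtr_sqr. Qed.

Lemma normc_sum (R : rcfType) (I : Type) (r : seq I) (P : pred I)
    (F : I -> R[i]) :
  normc (\sum_(i <- r | P i) F i) <= \sum_(i <- r | P i) normc (F i).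
Proof.
apply: (big_ind2 (fun z x => normc z <= x)) => [|z x w y zx wy|//].
  by rewrite Normc.normc0.
by rewrite (le_trans (normcD _ _)) ?lerD.
Qed.

Lemma normc_le_Re_Im (R : rcfType) (z : R[i]) :
  normc z <= `|complex.Re z| + `|complex.Im z|.
Proof.
rewrite {1}[z]complexE (le_trans (normcD _ _))// Normc.normcM !normcR.
by rewrite lerD2l /= expr0n /= expr1n add0r sqrtr1 mul1r.
Qed.

Lemma Re_le_normc (R : rcfType) (z : R[i]) : `|complex.Re z| <= normc z.
Proof. by rewrite -lecR; exact: (normc_ge_Re z). Qed.

Lemma Im_le_normc (R : rcfType) (z : R[i]) : `|complex.Im z| <= normc z.
Proof.
rewrite -normrN -ReiNIm (le_trans (Re_le_normc _))// Normc.normcM.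
by rewrite [X in _ * X]/= expr0n /= expr1n add0r sqrtr1 mulr1.
Qed.

(** * Powers of unimodular numbers *)

(** Pigeonhole: to each exponent attach the grid cells containing the real and imaginary parts of
    all the powers. Two exponents [k < k'] get the same cells, and multiplication by the unimodular
    [z ^+ k] turns the distance from [z ^+ (k' - k)] to 1 into the distance between the two
    powers. *)
Lemma simultaneous_return (R : realType) (s : seq R[i]) (e : R) :
  0 < e -> (forall z, z \in s -> normc z = 1) ->
  exists2 m, (0 < m)%N & forall z, z \in s -> normc (z ^+ m - 1) <= e.
Proof.
(* Real and imaginary parts each contribute one cell width 1/N, so 2/N must be at most [e]. *)
move=> e0 s1; pose N := (Num.truncn (2 / e)).+1.
have N0 : 0 < N%:R :> R by rewrite ltr0n.
have Ne : 2 / N%:R <= e.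
  by rewrite ler_pdivrMr// mulrC -ler_pdivrMr// ltW// truncnS_gt.
(* On [-1, 1] the truncation takes values from 0 to 2N, both included. *)
pose cell (x : R) : 'I_(2 * N).+1 := inord (Num.truncn ((1 + x) * N%:R)).
have cellP x y : `|x| <= 1 -> `|y| <= 1 -> cell x = cell y ->
    `|x - y| <= N%:R^-1.
  move=> x1 y1 /(congr1 (@nat_of_ord _)).
  have cell_bound (z : R) : `|z| <= 1 -> 0 <= (1 + z) * N%:R <= (2 * N)%:R.
    rewrite ler_norml natrM => /andP[z1 z2]; apply/andP; split.
      by rewrite mulr_ge0 ?(ltW N0)//; lra.
    by rewrite ler_pM2r//; lra.
  have cellE (z : R) : `|z| <= 1 -> cell z = Num.truncn ((1 + z) * N%:R) :> nat.
    move=> /cell_bound/andP[z0 zN].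
    rewrite /cell inordK// ltnS -(ler_nat R).
    by rewrite (le_trans _ zN)// truncn_le.
  rewrite !cellE// => exy.
  have /andP[/truncn_itv/andP[x2 x3] _] := cell_bound _ x1.
  have /andP[/truncn_itv/andP[y2 y3] _] := cell_bound _ y1.
  rewrite -(ler_pM2r N0) mulVf ?gt_eqF// -{1}(gtr0_norm N0) -normrM.
  rewrite exy in x2 x3; rewrite -natr1 in x3 y3.
  by rewrite ler_norml; apply/andP; split; lra.
pose T := #|{ffun 'I_(size s) -> 'I_(2 * N).+1 * 'I_(2 * N).+1}|.
pose F (k : 'I_T.+1) := [ffun i : 'I_(size s) =>
  (cell (complex.Re (s`_i ^+ k)), cell (complex.Im (s`_i ^+ k)))].
have [k [k' [kk' eqF]]] : exists k k' : 'I_T.+1, (k < k')%N /\ F k = F k'.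
  have /injectivePn[k [k' neq eqF]] : ~~ injectiveb F.
    by apply/negP => /injectiveP/leq_card; rewrite card_ord ltnn.
  move: neq; rewrite -val_eqE neq_ltn => /orP[lt|lt]; first by exists k, k'.
  by exists k', k.
exists (k' - k)%N; first by rewrite subn_gt0.
move=> z zs; have z1 := s1 _ zs.
have zX n : normc (z ^+ n) <= 1 by rewrite normcX z1 expr1n.
have -> : normc (z ^+ (k' - k) - 1) = normc (z ^+ k' - z ^+ k).
  rewrite -{2}(subnK (ltnW kk')) exprD -{2}[z ^+ k]mul1r -mulrBl Normc.normcM.
  by rewrite normcX z1 expr1n mulr1.
rewrite normcBC (le_trans (normc_le_Re_Im _))// (le_trans _ Ne)//.
have zi : (index z s < size s)%N by rewrite index_mem.
have /ffunP/(_ (Ordinal zi)) := eqF; rewrite !ffunE /= nth_index// => -[eR eI].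
have Rz n := le_trans (Re_le_normc (z ^+ n)) (zX n).
have Iz n := le_trans (Im_le_normc (z ^+ n)) (zX n).
have := cellP _ _ (Rz k) (Rz k') eR; have := cellP _ _ (Iz k) (Iz k') eI.
by rewrite !raddfB /=; lra.
Qed.

(* As long as [w = z ^+ (2 ^ n)] is within [1/2] of 1, squaring multiplies the
   distance to 1 by [normc (w + 1) >= 3/2]. *)
Lemma unimodular_power_far (R : realType) (z : R[i]) :
  z != 1 -> exists t, 2^-1 <= normc (z ^+ t - 1).
Proof.
move=> z1; apply: contrapT => /forallNP near.
pose a n := normc (z ^+ (2 ^ n) - 1).
have a_lt n : a n < 2^-1 by rewrite ltNge; apply/negP/near.
have a0 : 0 < a 0%N.
  rewrite lt_neqAle normc_ge0 andbT eq_sym; apply: contra z1 => /eqP.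
  by rewrite /a expn0 expr1 => /Normc.eq0_normc/eqP; rewrite subr_eq0.
have aS n : a n + a n / 2 <= a n.+1.
  have -> : a n.+1 = a n * normc (z ^+ (2 ^ n) + 1).
    by rewrite /a -Normc.normcM expnSr exprM -subr_sqr_1.
  have : normc 2%:R <= normc (z ^+ (2 ^ n) + 1) + a n.
    rewrite /a normcBC (le_trans _ (normcD _ _))//.
    by rewrite addrC subrKA -natr1.
  have -> : normc (2%:R : R[i]) = 2.
    by rewrite -[2%:R](rmorph_nat (real_complex R)) normcR ger0_norm.
  have := a_lt n; have := normc_ge0 (z ^+ (2 ^ n) - 1); rewrite -/(a n).
  by nra.
(* As [a] increases, each increment is at least [a 0 / 2]; this linear growth already exceeds 1/2 at
   the truncation of the inverse of [a 0]. *)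
have lin n : a 0%N + n%:R * (a 0%N / 2) <= a n.
  elim: n => [|n IH]; first by rewrite mul0r addr0.
  rewrite (le_trans _ (aS n))// -natr1 mulrDl mul1r addrA lerD//.
  by rewrite ler_pM2r ?invr_gt0// (le_trans _ IH)// lerDl mulr_ge0// ltW// divr_gt0.
have := lin (Num.truncn (a 0%N)^-1); have := a_lt (Num.truncn (a 0%N)^-1).
have := truncnS_gt (a 0%N)^-1; rewrite -natr1 -(ltr_pM2r a0) mulVf ?gt_eqF//.
by lra.
Qed.

(** * Exponential sums *)

Definition exp_sum (F : pzSemiRingType) (s : seq (F * F)) (k : nat) : F :=
  \sum_(p <- s) p.1 * p.2 ^+ k.

Lemma exp_sum_bound (R : rcfType) (s : seq (R[i] * R[i])) k :
  (forall p, p \in s -> normc p.2 <= 1) ->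
  normc (exp_sum s k) <= \sum_(p <- s) normc p.1.
Proof.
move=> s1; rewrite (le_trans (normc_sum _ _ _))// big_seq [leRHS]big_seq.
apply: ler_sum => p ps; rewrite Normc.normcM normcX.
by rewrite ler_piMr ?normc_ge0// exprn_ile1 ?normc_ge0// s1.
Qed.

Lemma exp_sum_decay (R : realType) (s : seq (R[i] * R[i])) :
  (forall p, p \in s -> normc p.2 < 1) ->
  forall e, 0 < e ->
    exists N, forall k, (N <= k)%N -> normc (exp_sum s k) < e.
Proof.
elim: s => [|p s IH] s1 e e0.
  by exists 0%N => k _; rewrite /exp_sum big_nil Normc.normc0.
have e2 : 0 < e / 2 by rewrite divr_gt0.
have [|N HN] := IH _ _ e2.
  by move=> q qs; rewrite s1// inE qs orbT.
(* The added 1 keeps the divisor positive when the coefficient is zero. *)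
have A0 : 0 < normc p.1 + 1 by rewrite ltr_wpDl ?normc_ge0.
have p1 : `|normc p.2| < 1 by rewrite ger0_norm ?normc_ge0// s1 ?mem_head.
have /cvgrPdist_lt/(_ _ (divr_gt0 e2 A0))[N' _ HN'] := cvg_expr p1.
exists (maxn N N') => k; rewrite geq_max => /andP[/HN Nk /HN' /=].
rewrite sub0r normrN ger0_norm ?exprn_ge0 ?normc_ge0// ltr_pdivlMr// => pk.
rewrite /exp_sum big_cons (le_lt_trans (normcD _ _))// [e]splitr.
rewrite ltrD// Normc.normcM normcX (le_lt_trans _ pk)// mulrC.
by rewrite ler_wpM2l ?exprn_ge0 ?normc_ge0// lerDl.
Qed.

Lemma exp_sum_unimodular (R : realType) (s : seq (R[i] * R[i])) :
  (forall p, p \in s -> normc p.2 <= 1) ->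
  forall e, 0 < e -> exists N, forall k, (N <= k)%N ->
    normc (exp_sum s k - exp_sum [seq p <- s | normc p.2 == 1] k) < e.
Proof.
move=> s1 e e0.
have [|N HN] := @exp_sum_decay R [seq p <- s | normc p.2 != 1] _ _ e0.
  move=> p; rewrite mem_filter => /andP[np /s1].
  by rewrite le_eqVlt (negbTE np).
exists N => k /HN; rewrite /exp_sum !big_filter.
by rewrite [X in normc (X - _)](bigID (fun p => normc p.2 == 1)) /= addrC addrK.
Qed.

(** The decaying terms cost [e / 3] at each of [k] and [k + m]; a simultaneous return of the
    unimodular ones costs the last third. *)
Lemma exp_sum_return (R : realType) (s : seq (R[i] * R[i])) :
  (forall p, p \in s -> normc p.2 <= 1) ->
  forall e, 0 < e -> exists m N, (0 < m)%N /\ forall k, (N <= k)%N ->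
    normc (exp_sum s (k + m) - exp_sum s k) <= e.
Proof.
move=> s1 e e0; have e3 : 0 < e / 3 by rewrite divr_gt0.
have [N HN] := exp_sum_unimodular s1 e3.
set t := [seq p <- s | normc p.2 == 1] in HN.
pose A := \sum_(p <- t) normc p.1.
have A0 : 0 < A + 1.
  by rewrite ltr_wpDl// sumr_ge0// => p _; exact: normc_ge0.
have [|m m0 Hm] := @simultaneous_return R [seq p.2 | p <- t] _ (divr_gt0 e3 A0).
  by move=> z /mapP[p]; rewrite mem_filter => /andP[/eqP p1 _] ->.
exists m, N; split=> // k Nk.
have step : normc (exp_sum t (k + m) - exp_sum t k) <= e / 3.
  rewrite /exp_sum -sumrB (le_trans (normc_sum _ _ _))//.
  have Ae : A * (e / 3 / (A + 1)) <= e / 3.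
    by rewrite mulrCA ler_piMr ?(ltW e3)// ler_pdivrMr// mul1r lerDl.
  rewrite (le_trans _ Ae)// /A mulr_suml big_seq [leRHS]big_seq.
  apply: ler_sum => p pt; have := pt; rewrite mem_filter => /andP[/eqP p1 _].
  rewrite exprD -mulrBr -[X in _ - X]mulr1 -mulrBr !Normc.normcM normcX p1.
  by rewrite expr1n mul1r ler_wpM2l ?normc_ge0// Hm// map_f.
have := HN k Nk; have := HN (k + m)%N (leq_trans Nk (leq_addr _ _)).
set a := exp_sum s _; set a' := exp_sum t _ in step *.
set b := exp_sum s _; set b' := exp_sum t _ in step *.
move=> aa' bb'.
have -> : a - b = (a - a') + ((a' - b') + (b' - b)) by ring.
have := normcD (a - a') ((a' - b') + (b' - b)).
have := normcD (a' - b') (b' - b); rewrite (normcBC b' b).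
by lra.
Qed.

(* Let [P] be the product of the ['X - q.2] over the other terms: [P], applied
   to the shift operator, isolates the term of [p], so that a combination of
   [size P] consecutive differences has the size of the difference of the
   powers of [p.2]. *)
Lemma exp_sum_far (R : realType) (s : seq (R[i] * R[i])) p :
  uniq [seq q.2 | q <- s] -> p \in s -> p.1 != 0 -> normc p.2 = 1 ->
  exists2 d, 0 < d & forall N M, 2^-1 <= normc (p.2 ^+ M - 1) ->
    exists2 k, (N <= k)%N & d <= normc (exp_sum s (k + M) - exp_sum s k).
Proof.
move=> us ps p0 p1.
pose P := \prod_(q <- s | q.2 != p.2) ('X - q.2%:P).
have Pp : P.[p.2] != 0.
  rewrite horner_prod prodf_seq_neq0; apply/allP => q _; apply/implyP => qp.
  by rewrite hornerXsubC subr_eq0 eq_sym.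
have Pq q : q \in s -> q != p -> P.[q.2] = 0.
  move=> qs qp; have q2 : q.2 != p.2.
    move: us; rewrite (perm_uniq (perm_map _ (perm_to_rem ps))) /=.
    move=> /andP[/mapP p_rem _]; apply/eqP => qp2; apply: p_rem; exists q => //.
    by move: qs; rewrite (perm_mem (perm_to_rem ps)) inE (negbTE qp).
  by rewrite /P (big_rem _ qs) /= q2 hornerM hornerXsubC subrr mul0r.
have normc_gt0 z : z != 0 -> 0 < normc z :> R.
  move=> z0; rewrite lt_neqAle normc_ge0 andbT eq_sym.
  by apply: contra z0 => /eqP/Normc.eq0_normc ->.
pose C := normc p.1 * normc P.[p.2].
have C0 : 0 < C by rewrite mulr_gt0 ?normc_gt0.
pose S := \sum_(i < size P) normc P`_i.
have S0 : 0 <= S by rewrite sumr_ge0// => i _; exact: normc_ge0.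
have S1 : 0 < S + 1 by rewrite ltr_wpDl.
(* If all differences were below this value, their combination with the coefficients of [P] would be
   at most S/(S + 1) times [C / 2]; but its modulus is at least [C / 2], the half coming from the
   assumption on [M]. *)
exists (C / 2 / (S + 1)); first by rewrite !divr_gt0.
move=> N M far; apply: contrapT => noK.
have small k : (N <= k)%N ->
    normc (exp_sum s (k + M) - exp_sum s k) < C / 2 / (S + 1).
  by move=> Nk; rewrite ltNge; apply/negP => dk; apply: noK; exists k.
have comb : \sum_(i < size P)
    P`_i * (exp_sum s (N + i + M) - exp_sum s (N + i)) =
    p.1 * p.2 ^+ N * (p.2 ^+ M - 1) * P.[p.2].
  transitivity (\sum_(q <- s) q.1 * q.2 ^+ N * (q.2 ^+ M - 1) * P.[q.2]).
    under eq_bigr do rewrite /exp_sum -sumrB mulr_sumr.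
    rewrite exchange_big /=; apply: eq_bigr => q _.
    rewrite horner_coef mulr_sumr; apply: eq_bigr => i _.
    by rewrite !exprD; ring.
  rewrite (bigD1_seq p) ?(map_uniq us)//= big_seq_cond big1 ?addr0// => q.
  by case/andP=> qs qp; rewrite Pq// mulr0.
have lower : C / 2 <= normc (p.1 * p.2 ^+ N * (p.2 ^+ M - 1) * P.[p.2]).
  rewrite !Normc.normcM normcX p1 expr1n mulr1 [leRHS]mulrAC.
  by rewrite ler_wpM2l ?(ltW C0).
have upper : normc (p.1 * p.2 ^+ N * (p.2 ^+ M - 1) * P.[p.2]) <=
    S * (C / 2 / (S + 1)).
  rewrite -comb (le_trans (normc_sum _ _ _))// mulr_suml.
  apply: ler_sum => i _; rewrite Normc.normcM ler_wpM2l ?normc_ge0//.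
  by rewrite ltW// small// leq_addr.
have := le_trans lower upper.
rewrite mulrCA -[leLHS]mulr1 ler_pM2l ?divr_gt0// ler_pdivlMr// mul1r.
by rewrite gerDl ler10.
Qed.

(** The first alternative lives in [R[i]], where the periodic sum takes its values, the second in
    [R], where intervals make sense. *)
Lemma exp_sum_limit_points (R : realType) (u : nat -> R)
    (s : seq (R[i] * R[i])) :
  uniq [seq p.2 | p <- s] ->
  (forall p, p \in s -> p.1 != 0 /\ normc p.2 <= 1) ->
  (forall k, (0 < k)%N -> (u k)%:C = exp_sum s k) ->
  let t := [seq p <- s | normc p.2 == 1] in
  (exists q, [/\ (0 < q)%N, forall p, p \in t -> p.2 ^+ q = 1 &
     limit_points (fun k => (u k)%:C) = limit_points (exp_sum t)]) \/
  (exists I : set R, nondegenerate_interval I /\ I `<=` limit_points u).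
Proof.
move=> us s1 uE t.
have {}s1 : (forall p, p \in s -> p.1 != 0) /\
    (forall p, p \in s -> normc p.2 <= 1) by split=> p /s1[].
case: s1 => s0 s1.
have [torsion|] := pselect
    (forall p, p \in t -> exists2 q, (0 < q)%N & p.2 ^+ q = 1).
  left; have [q q0 tq] : exists2 q, (0 < q)%N &
      forall p, p \in t -> p.2 ^+ q = 1.
    elim: (t) torsion => [|p r IH] torsion; first by exists 1%N.
    have [|q q0 rq] := IH.
      by move=> p' p'r; apply: torsion; rewrite inE p'r orbT.
    have [q' q'0 pq'] := torsion _ (mem_head _ _).
    exists (q * q')%N; first by rewrite muln_gt0 q0.
    move=> p'; rewrite inE => /predU1P[->|/rq p'q].
      by rewrite mulnC exprM pq' expr1n.
    by rewrite exprM p'q expr1n.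
  exists q; split=> //; apply: limit_points_eq => e e0.
  (* Positivity in [R[i]] forces [e] to be real. *)
  have eE : e = (complex.Re e)%:C by rewrite RRe_real// gtr0_real.
  have Re0 : 0 < complex.Re e by rewrite -ltcR -eE.
  have [N HN] := exp_sum_unimodular s1 Re0.
  exists N.+1 => k Nk; rewrite uE ?(leq_trans _ Nk)//.
  by rewrite eE; have := HN k (ltnW Nk); rewrite -ltcR.
move=> /existsNP[p /not_implyP[pt aperiodic]]; right.
move: pt; rewrite mem_filter => /andP[/eqP p1 ps].
have [d d0 far] := exp_sum_far us ps (s0 _ ps) p1.
have uB k l : (0 < k)%N -> (0 < l)%N ->
    `|u l - u k| = normc (exp_sum s l - exp_sum s k).
  by move=> k0 l0; rewrite -normcR rmorphB -(uE _ k0) -(uE _ l0).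
apply: (@interval_of_small_steps R u (\sum_(p <- s) normc p.1) d) => //.
  by move=> k k0; rewrite -normcR uE// exp_sum_bound.
move=> e e0 N.
have [m [N' [m0 small]]] := exp_sum_return s1 e0.
(* Since [p.2] is not a root of unity, its power [m] has itself a power far from 1, which gives a
   gap that is a multiple of [m]. *)
have pm : p.2 ^+ m != 1 by apply/eqP => pm; apply: aperiodic; exists m.
have [t' far_t] := unimodular_power_far pm.
rewrite -exprM in far_t.
have [k] := far (maxn N N').+1 _ far_t.
rewrite gtn_max => /andP[Nk N'k] dk.
have k0 : (0 < k)%N by rewrite (leq_trans _ Nk).
exists m, k, t'; split; first exact: ltnW.
  move=> k' kk'; have k'0 : (0 < k')%N := leq_trans k0 kk'.
  by rewrite uB ?addn_gt0 ?k'0// small// (leq_trans (ltnW N'k)).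
by rewrite uB ?addn_gt0 ?k0.
Qed.

(** * Application to synchronization counts *)

Lemma sync_expansionP (T : choiceType) (f g : T -> T) (R : realType) :
  sync_expansion f g R = [::] \/
  is_sync_expansion f g (sync_expansion f g R).
Proof.
by rewrite /sync_expansion; case: xgetP => [s _ sE|_]; [right | left].
Qed.

Theorem theorem45 (R : realType) (X : metricType R) (f g : X -> X)
    (hX : compact [set: X])
    (htame : sync_tame f g)
    (hrat : fps_rational (sync_zeta f g R)) :
  [\/ forall k : nat, (0 < k)%N -> sync_card f g k = 0%N,
      exists (alpha : 'I_(sync_n f g R) -> int)
             (eps : 'I_(sync_n f g R) -> R[i]) (q : nat),
        [/\ (0 < q)%N, forall j, eps j ^+ q = 1
          & limit_points (fun k : nat => (sync_normalized f g R k)%:C) =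
            limit_points (fun k : nat =>
              \sum_(j < sync_n f g R) (alpha j)%:~R * eps j ^+ k)]
    | exists I : set R, nondegenerate_interval I /\
        I `<=` limit_points (sync_normalized f g R)].
Proof.
set s := sync_expansion f g R; set l := sync_lambda f g R.
have [s_nil|s_cons] := eqVneq s [::].
  (* Then [l = 0], and the normalized sequence vanishes for [k > 0] because
     [x / 0 = 0]. *)
  have l0 : l = 0 by rewrite /l /sync_lambda -/s s_nil big_nil.
  have n0 : sync_n f g R = 0%N by rewrite /sync_n -/s s_nil.
  apply: Or32; exists (fun=> 0), (fun=> 1), 1%N; split=> //.
  (* Index 0 is skipped: there the power of [l] is 1, and [sync_card] counts the whole space if it
     is finite. *)
  apply: limit_points_eq => e e0; exists 1%N => -[//|k] _.
  rewrite big1 => [|j _]; last by rewrite mul0r.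
  by rewrite /sync_normalized -/l l0 expr0n invr0 mulr0 subrr normr0.
have [s0|[us sP sE]] := sync_expansionP f g R.
  by rewrite /s s0 in s_cons.
rewrite -/s in us sP sE.
have le_l p : p \in s -> normc p.2 <= l.
  by move=> ps; exact: (@le_bigmax_seq _ R _ s 0 p xpredT (fun p => normc p.2)).
have l0 : 0 < l.
  case: s s_cons sP le_l {us sE} => [//|p s'] _ sP le_l.
  have [_ p0 _] := sP p (mem_head _ _).
  rewrite (lt_le_trans _ (le_l p (mem_head _ _)))// lt_neqAle normc_ge0 andbT.
  by rewrite eq_sym; apply: contra p0 => /eqP/Normc.eq0_normc ->.
have lC0 : l%:C != 0.
  by rewrite -(rmorph0 (real_complex R)) (inj_eq (@complexI R)) gt_eqF.
have normc_div z : normc (z / l%:C) = normc z / l.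
  by rewrite Normc.normcM Normc.normcV normcR gtr0_norm.
(* Division by [l] brings all bases into the closed unit disc; the unimodular ones come from the
   terms counted by [sync_n]. *)
pose scale (p : int * R[i]) : R[i] * R[i] := (p.1%:~R, p.2 / l%:C).
have [] := @exp_sum_limit_points R (sync_normalized f g R) (map scale s).
- rewrite -map_comp (map_comp (fun z => z / l%:C) snd) map_inj_uniq//.
  by apply: mulIf; rewrite invr_eq0.
- move=> _ /mapP[p ps ->] /=; have [p1 _ _] := sP p ps; split.
    by rewrite intr_eq0.
  by rewrite normc_div ler_pdivrMr// mul1r le_l.
- move=> k k0; rewrite /sync_normalized rmorphM rmorph_nat /= sE// -/l.
  rewrite fmorphV rmorphXn /= /exp_sum big_map mulr_suml.
  by apply: eq_bigr => p _; rewrite /= -mulrA expr_div_n.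
- pose t := [seq p <- s | normc p.2 == l].
  have -> : [seq p <- map scale s | normc p.2 == 1] = map scale t.
    rewrite filter_map; congr map; apply: eq_filter => p /=.
    by rewrite normc_div -(inj_eq (mulIf (lt0r_neq0 l0))) divfK ?lt0r_neq0// mul1r.
  have size_t : size t = sync_n f g R by rewrite size_filter.
  move=> [q [q0 tq tE]]; apply: Or32.
  exists (fun j => (nth (0, 0) t j).1), (fun j => (scale (nth (0, 0) t j)).2), q.
  split=> // [j|]; first by rewrite tq// map_f// mem_nth// size_t.
  rewrite tE; congr limit_points; apply/funext => k.
  by rewrite /exp_sum big_map (big_nth (0, 0)) big_mkord size_t.
- exact: Or33.
Qed.
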